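(* Let $S$ be a $(2,\omega)$-divisible Cu-semigroup satisfying (O5), (O6) and (O7). Let $x\in S$ and let $u'\in L_x$. Then there exists $w\in S_{\mathrm{soft}}$ such that $u'\ll w\le x\le\infty w$ and $\lambda(w)=\lambda(x)$ for every $\lambda\in F(S)$.
   Context: A Cu-semigroup is a positively ordered commutative monoid satisfying (O1)–(O4): increasing sequences have suprema; each element is the supremum of a $\ll$-increasing sequence; $x'\ll x,y'\ll y\Rightarrow x'+y'\ll x+y$; suprema of increasing sequences are additive. $x\ll y$ means whenever $y\le\sup z_n$ for an increasing sequence, $x\le z_m$ for some $m$. (O5): if $x+y\le z$, $x'\ll x$, $y'\ll y$ then some $c$ has $y'\ll c$ and $x'+c\le z\le x+c$. (O6): if $x'\ll x\le y+z$ then some $v,w$ have $v\le x,y$, $w\le x,z$, $x'\le v+w$. (O7): if $x'\ll x\le w$ and $y'\ll y\le w$ then some $z$ has $x',y'\ll z\le w,x+y$. $\infty x=\sup_n nx$. $x$ is strongly soft if for every $x'\ll x$ there is $t$ with $x'+t\ll x$ and $x'\ll\infty t$; $S_{\mathrm{soft}}$ is the set of strongly soft elements. $S$ is $(2,\omega)$-divisible if for all $x'\ll x$ there is $y$ with $2y\le x$ and $x'\le\infty y$. $F(S)$ is the set of functionals: monoid morphisms $S\to[0,\infty]$ preserving order and suprema of increasing sequences. For $x\in S$, $L_x:=\{u'\in S:\ u'\ll u\ll x \text{ for some } u\in S_{\mathrm{soft}}\}$. *)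

(* Defs.v *)
From HB Require Import structures.
From mathcomp Require Import all_boot all_order all_algebra.
From mathcomp Require Import reals constructive_ereal Rstruct.


Set Implicit Arguments.
Unset Strict Implicit.
Unset Printing Implicit Defensive.

Import Order.TTheory GRing.Theory Num.Theory.

Section OrderedMonoid.
Variables (S : Type) (add : S -> S -> S) (zero : S) (le : S -> S -> Prop).

Definition increasing (f : nat -> S) : Prop := forall n, le (f n) (f n.+1).

Definition is_sup (f : nat -> S) (s : S) : Prop :=
  (forall n, le (f n) s) /\ (forall t, (forall n, le (f n) t) -> le s t).

Definition way_below (x y : S) : Prop :=
  forall (z : nat -> S) (s : S), increasing z -> is_sup z s -> le y s ->
  exists m, le x (z m).

Fixpoint nmul (n : nat) (x : S) : S :=
  match n with O => zero | n'.+1 => add (nmul n' x) x end.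

Definition le_infty (x t : S) : Prop :=
  exists y, is_sup (fun n => nmul n t) y /\ le x y.

Definition wb_infty (x t : S) : Prop :=
  exists y, is_sup (fun n => nmul n t) y /\ way_below x y.

End OrderedMonoid.

Record CuSemigroup := {
  cu_car :> Type;
  cu_add : cu_car -> cu_car -> cu_car;
  cu_zero : cu_car;
  cu_le : cu_car -> cu_car -> Prop;
  cu_le_refl : forall x, cu_le x x;
  cu_le_trans : forall x y z, cu_le x y -> cu_le y z -> cu_le x z;
  cu_le_antisym : forall x y, cu_le x y -> cu_le y x -> x = y;
  cu_addA : forall x y z, cu_add x (cu_add y z) = cu_add (cu_add x y) z;
  cu_addC : forall x y, cu_add x y = cu_add y x;
  cu_add0 : forall x, cu_add x cu_zero = x;
  cu_le_add : forall x y z, cu_le x y -> cu_le (cu_add x z) (cu_add y z);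
  cu_ge0 : forall x, cu_le cu_zero x;
  cu_O1 : forall f, increasing cu_le f -> exists s, is_sup cu_le f s;
  cu_O2 : forall x, exists f, (forall n, way_below cu_le (f n) (f n.+1)) /\
                              is_sup cu_le f x;
  cu_O3 : forall x' x y' y, way_below cu_le x' x -> way_below cu_le y' y ->
            way_below cu_le (cu_add x' y') (cu_add x y);
  cu_O4 : forall f g s t, increasing cu_le f -> increasing cu_le g ->
            is_sup cu_le f s -> is_sup cu_le g t ->
            is_sup cu_le (fun n => cu_add (f n) (g n)) (cu_add s t)
}.

Section CuDefs.
Variable S : CuSemigroup.

Local Notation "x + y" := (cu_add x y).
Local Notation "x <= y" := (cu_le x y).
Local Notation "x \ll y" := (way_below (@cu_le S) x y) (at level 70).

Definition O5 : Prop :=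
  forall x y z x' y' : S, x + y <= z -> x' \ll x -> y' \ll y ->
  exists c : S, y' \ll c /\ x' + c <= z /\ z <= x + c.

Definition O6 : Prop :=
  forall x' x y z : S, x' \ll x -> x <= y + z ->
  exists v w : S, v <= x /\ v <= y /\ w <= x /\ w <= z /\ x' <= v + w.

Definition O7 : Prop :=
  forall x' x y' y w : S, x' \ll x -> x <= w -> y' \ll y -> y <= w ->
  exists z : S, x' \ll z /\ y' \ll z /\ z <= w /\ z <= x + y.

Definition two_omega_divisible : Prop :=
  forall x' x : S, x' \ll x ->
  exists y : S, y + y <= x /\ le_infty (@cu_add S) (@cu_zero S) (@cu_le S) x' y.

Definition strongly_soft (x : S) : Prop :=
  forall x' : S, x' \ll x ->
  exists t : S, x' + t \ll x /\ wb_infty (@cu_add S) (@cu_zero S) (@cu_le S) x' t.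

Definition L_set (x u' : S) : Prop :=
  exists u : S, strongly_soft u /\ u' \ll u /\ u \ll x.

Definition functional (lam : S -> \bar Rdefinitions.R) : Prop :=
  (forall x, (0 <= lam x)%E) /\
  lam (@cu_zero S) = 0%E /\
  (forall x y, lam (x + y) = (lam x + lam y)%E) /\
  (forall x y, x <= y -> (lam x <= lam y)%E) /\
  (forall (f : nat -> S) (s : S), increasing (@cu_le S) f ->
     is_sup (@cu_le S) f s ->
     (forall n, (lam (f n) <= lam s)%E) /\
     (forall b : \bar Rdefinitions.R, (forall n, (lam (f n) <= b)%E) -> (lam s <= b)%E)).

End CuDefs.

(* Main.v *)
Require Import Defs.
From mathcomp Require Import all_boot all_order all_algebra.
From mathcomp Require Import reals constructive_ereal Rstruct.
From Stdlib Require Import ClassicalEpsilon.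
From mathcomp Require Import lra.

Set Implicit Arguments.
Unset Strict Implicit.
Unset Printing Implicit Defensive.

Import Order.TTheory GRing.Theory Num.Theory.

(** Every [a] in [L_x] is way below a soft [u], so [a + t << u] for some [t]
with [a <= ∞t], and [a + t] is again in [L_x].  The crucial step enlarges an
element [a] of [L_x] to some [a1] in [L_x] such that [N x' <= (N + 1) a1], for
prescribed [N] and [x' << x].  To do so, one finds [R] with
[a + (N + 1) R <= x] whose multiples dominate everything relevant, and a soft
[r' << r << R].  By (O5), [r] has an almost complement [c] in [x] with
[a + N r << c]; by (O6), [x'] splits as [v + c1] with [v <= r] and [c1 <= c];
by (O7), some [z <= c] dominates both [a + N v] and [c1], up to [<<].  Then
[z + r'] is soft, lies below [x], and the defect [v] is absorbed since
[N v <= z].  Iterating along a [<<]-increasing sequence with supremum [x] gives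
an increasing sequence in [L_x], whose supremum is the desired [w]. *)

(** The relation [E] may depend on the stage, since the multiplicity prescribed at each enlargement
    grows along the sequence. *)
Lemma dependent_choice (T : Type) (P : T -> Prop) (E : nat -> T -> T -> Prop)
    (a : T) :
  P a -> (forall n b, P b -> exists c, P c /\ E n b c) ->
  exists f : nat -> T, f 0 = a /\ forall n, P (f n) /\ E n (f n) (f n.+1).
Proof.
move=> Pa step.
pose next n (b : {b | P b}) : {c | P c /\ E n (sval b) c} :=
  constructive_indefinite_description _ (step n (sval b) (svalP b)).
pose fix g n : {b | P b} :=
  if n is m.+1 then exist P (sval (next m (g m))) (proj1 (svalP (next m (g m))))
  else exist P a Pa.
exists (fun n => sval (g n)); split=> // n; split; first exact: svalP.
exact: (proj2 (svalP (next n (g n)))).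
Qed.

Section CuTheory.
Variable S : CuSemigroup.
Implicit Types (x y z t u v w a b c r s : S) (f g : nat -> S) (m n k : nat).

Local Notation "x + y" := (cu_add x y).
Local Notation "x <= y" := (cu_le x y).
Local Notation "x \ll y" := (way_below (@cu_le S) x y) (at level 70).
Local Notation "n *+ x" := (nmul (@cu_add S) (@cu_zero S) n x)
  (at level 40, left associativity).
Local Notation "x <=oo y" := (le_infty (@cu_add S) (@cu_zero S) (@cu_le S) x y)
  (at level 70).
Local Notation incr := (increasing (@cu_le S)).
Local Notation sup := (is_sup (@cu_le S)).
Local Notation "0" := (@cu_zero S).
Local Notation lexx := cu_le_refl.
Local Notation le_tr := cu_le_trans.
#[local] Hint Resolve cu_le_refl cu_ge0 : core.

(** * Order, addition and the relation [\ll] *)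

Lemma add0x x : 0 + x = x.
Proof. by rewrite cu_addC cu_add0. Qed.

Lemma leD x y z t : x <= y -> z <= t -> x + z <= y + t.
Proof.
move=> xy zt; apply: (le_tr (cu_le_add z xy)).
by rewrite (cu_addC y z) (cu_addC y t); apply: cu_le_add.
Qed.

Lemma le_addr x y : x <= x + y.
Proof. by rewrite -{1}(cu_add0 x); apply: leD. Qed.

Lemma le_addl x y : x <= y + x.
Proof. by rewrite cu_addC; apply: le_addr. Qed.

Lemma addACA x y z t : (x + y) + (z + t) = (x + z) + (y + t).
Proof.
by rewrite -!cu_addA; congr (_ + _); rewrite !cu_addA (cu_addC y z).
Qed.

Lemma incr_le f m n : incr f -> (m <= n)%N -> f m <= f n.
Proof.
move=> incf; elim: n => [|n IH]; first by rewrite leqn0 => /eqP ->.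
by rewrite leq_eqVlt => /orP[/eqP -> //|/IH mn]; apply: le_tr mn (incf n).
Qed.

Lemma sup_const x : sup (fun=> x) x.
Proof. by split=> // t /(_ 0%N). Qed.

Lemma wb_le x y : x \ll y -> x <= y.
Proof. by move=> /(_ (fun=> y) y) [] //; exact: sup_const. Qed.

Lemma le_wb_trans x y z : x <= y -> y \ll z -> x \ll z.
Proof.
move=> xy yz f s incf supf zs; have [m ym] := yz f s incf supf zs.
by exists m; apply: le_tr xy ym.
Qed.

Lemma wb_le_trans x y z : x \ll y -> y <= z -> x \ll z.
Proof. by move=> xy yz f s incf supf zs; apply: (xy f s) => //; apply: le_tr zs. Qed.

Lemma wb0 x : 0 \ll x.
Proof. by move=> f s _ _ _; exists 0%N. Qed.

Lemma wb_approx x :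
  exists f, [/\ incr f, sup f x & forall n, f n \ll f n.+1 /\ f n \ll x].
Proof.
have [f [wbf supf]] := cu_O2 x; exists f; split=> // n; first exact: wb_le.
by split=> //; apply: wb_le_trans (wbf n) _; apply: (proj1 supf).
Qed.

Lemma wb_interpolate x y : x \ll y -> exists z, x \ll z /\ z \ll y.
Proof.
move=> xy; have [f [incf supf wbf]] := wb_approx y.
have [m xm] := xy f y incf supf (lexx y).
by exists (f m.+1); split; [apply: le_wb_trans xm (wbf m).1|exact: (wbf _).2].
Qed.

Lemma wb_join x y z : x \ll z -> y \ll z -> exists t, [/\ x \ll t, y \ll t & t \ll z].
Proof.
move=> xz yz; have [f [incf supf wbf]] := wb_approx z.
have [m xm] := xz f z incf supf (lexx z).
have [n yn] := yz f z incf supf (lexx z).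
exists (f (maxn m n).+1); split; last exact: (wbf _).2.
  apply: le_wb_trans (wbf _).1; apply: le_tr xm _.
  by apply: incr_le => //; exact: leq_maxl.
apply: le_wb_trans (wbf _).1; apply: le_tr yn _.
by apply: incr_le => //; exact: leq_maxr.
Qed.

(** * Multiples and domination by [∞y] *)

Lemma le_nmul n x y : x <= y -> n *+ x <= n *+ y.
Proof. by move=> xy; elim: n => //= n IH; apply: leD. Qed.

Lemma incr_nmul x : incr (fun n => n *+ x).
Proof. by move=> n; apply: le_addr. Qed.

Lemma nmul1 x : 1 *+ x = x.
Proof. exact: add0x. Qed.

Lemma nmulDl m n x : (m + n)%N *+ x = m *+ x + n *+ x.
Proof. by elim: n => [|n IH] /=; rewrite ?addn0 ?cu_add0 // addnS /= IH cu_addA. Qed.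

Lemma nmulDr n x y : n *+ (x + y) = n *+ x + n *+ y.
Proof. by elim: n => [|n IH] /=; rewrite ?cu_add0 // IH addACA. Qed.

Lemma wb_nmul n x y : x \ll y -> n *+ x \ll n *+ y.
Proof. by move=> xy; elim: n => [|n IH] /=; [exact: wb0|exact: cu_O3]. Qed.

Lemma sup_nmul n f x : incr f -> sup f x -> sup (fun k => n *+ f k) (n *+ x).
Proof.
move=> incf supf; elim: n => [|n IH] /=; first exact: sup_const.
by apply: cu_O4 => // k; apply: le_nmul.
Qed.

Lemma wb_nmulP n x y : x \ll n *+ y -> exists z, z \ll y /\ x <= n *+ z.
Proof.
move=> xy; have [f [incf supf wbf]] := wb_approx y.
have inc_nf : incr (fun k => n *+ f k) by move=> k; apply: le_nmul.
have [m xm] := xy _ _ inc_nf (sup_nmul n incf supf) (lexx _).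
by exists (f m); split=> //; exact: (wbf m).2.
Qed.

Lemma wb_addP x y z :
  x \ll y + z -> exists y' z', [/\ y' \ll y, z' \ll z & x <= y' + z'].
Proof.
move=> xyz; have [f [incf supf wbf]] := wb_approx y.
have [g [incg supg wbg]] := wb_approx z.
have inc_fg : incr (fun k => f k + g k) by move=> k; apply: leD.
have [m xm] := xyz _ _ inc_fg (cu_O4 incf incg supf supg) (lexx _).
by exists (f m), (g m); split=> //; [exact: (wbf m).2|exact: (wbg m).2].
Qed.

Lemma sup_nmul_add_le x s : sup (fun n => n *+ x) s -> s + s <= s.
Proof.
move=> sups; apply: (proj2 (cu_O4 (incr_nmul x) (incr_nmul x) sups sups)) => n.
by rewrite -nmulDl; apply: (proj1 sups).
Qed.

Lemma le_le_infty x y z : x <= y -> y <=oo z -> x <=oo z.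
Proof. by move=> xy [s [sups ys]]; exists s; split=> //; apply: le_tr ys. Qed.

Lemma le_nmul_infty n x y : x <= n *+ y -> x <=oo y.
Proof.
move=> xy; have [s sups] := cu_O1 (incr_nmul y); exists s; split=> //.
by apply: le_tr xy _; apply: (proj1 sups n).
Qed.

Lemma le_infty_of_le x y : x <= y -> x <=oo y.
Proof. by move=> xy; apply: (@le_nmul_infty 1); rewrite nmul1. Qed.

Lemma le_infty_add x y z : x <=oo z -> y <=oo z -> x + y <=oo z.
Proof.
move=> [s [sups xs]] [s' [sups' ys']].
have s's : s' <= s by apply: sups'.2; exact: sups.1.
by exists s; split=> //; apply: le_tr (sup_nmul_add_le sups); apply: leD => //; apply: le_tr s's.
Qed.

Lemma le_infty_nmul n x y : x <=oo y -> n *+ x <=oo y.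
Proof.
move=> xy; elim: n => [|n IH] /=; last exact: le_infty_add.
exact: (@le_nmul_infty 0%N).
Qed.

Lemma le_infty_trans x y z : x <=oo y -> y <=oo z -> x <=oo z.
Proof.
move=> [s [sups xs]] yz; have [s' sups'] := cu_O1 (incr_nmul z).
exists s'; split=> //; apply: le_tr xs _; apply: (proj2 sups) => n.
have [s2 [sups2 ns2]] := le_infty_nmul n yz.
by apply: le_tr ns2 _; apply: (proj2 sups2); exact: sups'.1.
Qed.

(** Some [x1] between [x'] and [x] lies below a finite multiple of [y], and [y] can then be shrunk
    because multiples commute with suprema. *)
Lemma wb_le_infty_approx x x' y :
  x' \ll x -> x <=oo y -> exists y', y' \ll y /\ x' <=oo y'.
Proof.
move=> x'x [s [sups xs]]; have [x1 [x'x1 x1x]] := wb_interpolate x'x.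
have [n x1n] := x1x _ s (incr_nmul y) sups xs.
have [y' [y'y x'y']] := wb_nmulP (wb_le_trans x'x1 x1n).
by exists y'; split=> //; apply: le_nmul_infty x'y'.
Qed.

(** * Strongly soft elements *)

(** Both strict relations in the definition are recovered by interpolating between [x'] and [x] and
    shrinking [t]. *)
Lemma strongly_soft_le x :
  (forall x', x' \ll x -> exists t, x' + t <= x /\ x' <=oo t) -> strongly_soft x.
Proof.
move=> soft x' x'x; have [x1 [x'x1 x1x]] := wb_interpolate x'x.
have [x2 [x'x2 x2x1]] := wb_interpolate x'x1.
have [t [x1t x1oo]] := soft _ x1x.
have [t' [t't [s [sups x2s]]]] := wb_le_infty_approx x2x1 x1oo.
exists t'; split; first by apply: wb_le_trans x1t; apply: cu_O3.
by exists s; split=> //; apply: wb_le_trans x'x2 x2s.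
Qed.

Lemma strongly_softP x x' : strongly_soft x -> x' \ll x ->
  exists t, x' + t \ll x /\ x' <=oo t.
Proof.
move=> soft /soft [t [x't [s [sups x's]]]]; exists t; split=> //.
by exists s; split=> //; apply: wb_le.
Qed.

(** An approximant of [z + r] lies below some [z' + r3], with [r3 << r] large enough that its
    multiples dominate [z']; the remainder of [r3] in [r] then serves for the sum. *)
Lemma strongly_soft_add z r :
  z <=oo r -> strongly_soft r -> strongly_soft (z + r).
Proof.
move=> zr softr; apply: strongly_soft_le => a /wb_addP [z' [r1 [z'z r1r az]]].
have [r2 [r2r z'r2]] := wb_le_infty_approx z'z zr.
have [r3 [r13 r23 r3r]] := wb_join r1r r2r.
have [t [r3t r3oo]] := strongly_softP softr r3r.
have ar3 : a <= z' + r3 by apply: le_tr az _; apply: leD => //; apply: wb_le.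
exists t; split.
  apply: le_tr (leD ar3 (lexx t)) _; rewrite -cu_addA.
  by apply: leD; apply: wb_le.
apply: le_le_infty ar3 _; apply: le_infty_add => //.
apply: le_infty_trans z'r2 _; apply: le_le_infty r3oo.
exact: wb_le.
Qed.

Lemma strongly_soft_sup f s : incr f -> sup f s ->
  (forall n, exists t, f n + t <= f n.+1 /\ f n <=oo t) -> strongly_soft s.
Proof.
move=> incf supf step; apply: strongly_soft_le => a /(_ f s incf supf (lexx s)).
move=> [n an]; have [t [fnt fnoo]] := step n.
exists t; split; last exact: le_le_infty fnoo.
by apply: le_tr (leD an (lexx t)) _; apply: le_tr fnt _; apply: (proj1 supf).
Qed.

(** * Divisibility and small soft elements *)

Hypothesis hdiv : two_omega_divisible S.

Lemma divisible_halving x' x : x' \ll x ->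
  exists y y', [/\ y' \ll y, y + y <= x & x' <=oo y'].
Proof.
move=> /wb_interpolate [x1 [x'x1 x1x]].
have [y [yx x1y]] := hdiv x1x.
by have [y' [y'y x'y']] := wb_le_infty_approx x'x1 x1y; exists y, y'.
Qed.

Lemma divisible_nmul n x' x : x' \ll x ->
  exists y, [/\ y <= x, n *+ y <= x & x' <=oo y].
Proof.
elim: n x' x => [|n IH] x' x x'x.
  by exists x; split=> //; apply: le_infty_of_le; apply: wb_le.
have [y [y' [y'y yx x'y']]] := divisible_halving x'x.
have [z [zy nzy y'z]] := IH _ _ y'y.
exists z; split.
- by apply: le_tr zy _; apply: le_tr yx; apply: le_addr.
- by apply: le_tr yx; apply: leD.
- exact: le_infty_trans y'z.
Qed.

(* Halving repeatedly gives [2 y_(n+1) <= y_n], and the soft element is the sum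
   of the [y_n'], with [y_n' << y_n]. *)
Lemma soft_divisible x' x : x' \ll x ->
  exists y, [/\ strongly_soft y, y \ll x & x' <=oo y].
Proof.
move=> /wb_interpolate [x0 [x'x0 x0x]].
have [p [p0 step]] := @dependent_choice (S * S) (fun p => p.1 \ll p.2)
  (fun _ p q => q.2 + q.2 <= p.2 /\ p.1 <=oo q.1) (x', x0) x'x0
  (fun _ p pwb => let: ex_intro y (ex_intro y' (And3 a b c)) :=
     divisible_halving pwb in ex_intro _ (y', y) (conj a (conj b c))).
pose fix s n := if n is m.+1 then s m + (p m.+1).1 else 0.
have incs : incr s by move=> n; apply: le_addr.
(* The component [(p n).2] is the room left below [x0]; half of it pays for the next summand. *)
have s_le n : s n + (p n).2 <= x0.
  elim: n => [|n IH]; first by rewrite /= add0x p0.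
  apply: le_tr IH; rewrite /= -cu_addA; apply: leD => //.
  have [_ [le2 _]] := step n; apply: le_tr le2; apply: leD => //.
  exact: wb_le (step n.+1).1.
have s_oo n : s n <=oo (p n.+1).1.
  elim: n => [|n IH] /=; first exact: (@le_nmul_infty 0%N).
  by apply: le_infty_trans (proj2 (step n.+1).2); apply: le_infty_add => //;
    apply: le_infty_of_le.
have [y supy] := cu_O1 incs; exists y; split.
- apply: (strongly_soft_sup incs supy) => n; exists (p n.+1).1.
  by split; [exact: lexx|exact: s_oo].
- apply: le_wb_trans x0x; apply: (proj2 supy) => n.
  by apply: le_tr (s_le n); apply: le_addr.
- have [_ [_]] := step 0%N; rewrite p0 => /le_infty_trans; apply.
  by apply: le_infty_of_le; apply: le_tr (supy.1 1%N); apply: le_addl.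
Qed.

(** * Enlarging elements of [L_x] *)

Hypothesis h5 : O5 S.

(** The softness remainder of [u] goes into an (O5)-complement [c], so multiples of [c] dominate
    [u1] and hence [x <= u1 + c]; [r] is then obtained by dividing [c]. *)
Lemma soft_almost_complement u u' x x' n :
  strongly_soft u -> u' \ll u -> u <= x -> x' \ll x ->
  exists r, u' + n *+ r <= x /\ x' <=oo r.
Proof.
move=> softu u'u ux x'x; have [u1 [u'u1 u1u]] := wb_interpolate u'u.
have [u2 [u12 u2u]] := wb_interpolate u1u.
have [t [u2t u2oo]] := strongly_softP softu u2u.
have [t' [t't u1t']] := wb_le_infty_approx u12 u2oo.
have u1tx : u1 + t <= x.
  by apply: le_tr ux; apply: le_tr (wb_le u2t); apply: leD => //; apply: wb_le.
have [c [t'c [u'cx xu1c]]] := h5 u1tx u'u1 t't.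
have xc : x <=oo c.
  apply: le_le_infty xu1c _; apply: le_infty_add; last exact: le_infty_of_le.
  by apply: le_infty_trans u1t' _; apply: le_infty_of_le; apply: wb_le.
have [c' [c'c x'c']] := wb_le_infty_approx x'x xc.
have [r [_ nrc c'r]] := divisible_nmul n c'c.
exists r; split; last exact: le_infty_trans c'r.
by apply: le_tr u'cx; apply: leD.
Qed.

Hypotheses (h6 : O6 S) (h7 : O7 S).

Lemma L_set_enlarge n x x' a : L_set x a -> x' \ll x ->
  exists b, [/\ L_set x b, a <= b & n *+ x' <= n.+1 *+ b].
Proof.
move=> [u [softu [au ux]]] x'x.
(* The chains are [x' << x4 << x3 << x1 << x2 << x] and [a << u1 << u2 << u << x4]. *)
have [x4 [x'x4 ux4 x4x]] := wb_join x'x ux.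
have [x3 [x43 x3x]] := wb_interpolate x4x.
have [x1 [x31 x1x]] := wb_interpolate x3x.
have [x2 [x12 x2x]] := wb_interpolate x1x.
have [u1 [au1 u1u]] := wb_interpolate au.
have [u2 [u12 u2u]] := wb_interpolate u1u.
have ux3 : u <= x3 by apply: le_tr (wb_le ux4) (wb_le x43).
have x32 : x3 <= x2 by apply: le_tr (wb_le x31) (wb_le x12).
have [R [u2R x1R]] := soft_almost_complement n.+1 softu u2u (le_tr ux3 x32) x12.
have [r0 [r0R x3r0]] := wb_le_infty_approx x31 x1R.
have [r [r0r rR]] := wb_interpolate r0R.
have [r' [softr' r'r r0r']] := soft_divisible r0r.
have x3r' : x3 <=oo r' by apply: le_infty_trans r0r'.
(* One of the [n.+1] copies of [R] is traded for [r]; the other [n] make room for [n *+ v] in the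
   complement of [r]. *)
have ru2 : r + (u2 + n *+ R) <= x2.
  by apply: le_tr u2R; rewrite cu_addC -cu_addA; do !apply: leD => //; apply: wb_le.
have [c [u1c [r'c x2c]]] := h5 ru2 r'r (cu_O3 u12 (wb_nmul rR)).
have [v [c1 [vx3 [vr [c1x3 [c1c x4v]]]]]] := h6 x43 (le_tr x32 x2c).
have [v0 [c0 [v0v c01 x'v]]] := wb_addP (wb_le_trans x'x4 x4v).
have vc : u1 + n *+ v <= c.
  by apply: le_tr (wb_le u1c); apply: leD => //; apply: le_nmul.
have [z [vz [c0z [zc zle]]]] := h7 (cu_O3 au1 (wb_nmul v0v)) vc c01 c1c.
have [b [vb c0b bz]] := wb_join vz c0z.
(* The second upper bound from (O7) is used here, with [v] and [c1] below [x3] by (O6), and [x3]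
   dominated by [r']. *)
have z_oo : z <=oo r'.
  apply: le_le_infty zle _; do !apply: le_infty_add.
  - by apply: le_le_infty x3r'; apply: le_tr ux3; apply: wb_le.
  - by apply: le_infty_nmul; apply: le_le_infty x3r'.
  - exact: le_le_infty x3r'.
exists b; split.
- exists (z + r'); split; first exact: strongly_soft_add.
  split; first by apply: wb_le_trans bz (le_addr _ _).
  apply: le_wb_trans x2x; apply: le_tr r'c; rewrite cu_addC.
  exact: leD.
- by apply: le_tr (wb_le vb); apply: le_addr.
- apply: le_tr (le_nmul n x'v) _; rewrite nmulDr [_ + n *+ c0]cu_addC /=.
  apply: leD; first by apply: le_nmul; apply: wb_le.
  by apply: le_tr (wb_le vb); apply: le_addl.
Qed.

(** Enlarging [a + t] instead of [a] keeps a remainder [t] at each step, which makes the limit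
    soft. *)
Lemma L_set_step n x x' a : L_set x a -> x' \ll x ->
  exists b, L_set x b /\
    ((exists t, a + t <= b /\ a <=oo t) /\ n *+ x' <= n.+1 *+ b).
Proof.
move=> [u [softu [au ux]]] x'x; have [t [atu at_oo]] := strongly_softP softu au.
have Lat : L_set x (a + t) by exists u.
have [b [Lb atb nb]] := L_set_enlarge n Lat x'x.
by exists b; split=> //; split=> //; exists t.
Qed.

Lemma L_set_limit x u' : L_set x u' ->
  exists w f, [/\ strongly_soft w, u' \ll w, w <= x & [/\ incr f, sup f x &
    forall k n, (k <= n)%N -> n.+1 *+ f k <= n.+2 *+ w]].
Proof.
(* Starting from [u1] instead of [u'] ensures [u' << u1 <= w]. *)
move=> [u [softu [u'u ux]]]; have [u1 [u'u1 u1u]] := wb_interpolate u'u.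
have [f [incf supf wbf]] := wb_approx x.
have Lu1 : L_set x u1 by exists u.
(* Stage [n] uses multiplicity [n.+1] and the approximant [f n], which is above [f k] for all
   [k <= n]. *)
have [a [a0 step]] := dependent_choice Lu1
  (fun n b Lb => L_set_step n.+1 Lb (wbf n).2).
have inca : incr a.
  by move=> n; have [_ [[t [le_at _]] _]] := step n; apply: le_tr le_at; apply: le_addr.
have [w supw] := cu_O1 inca; exists w, f; split.
- by apply: strongly_soft_sup inca supw _ => n; exact: (step n).2.1.
- by apply: wb_le_trans u'u1 _; rewrite -a0; exact: (proj1 supw 0%N).
- apply: (proj2 supw) => n; have [[v [_ [av vx]]] _] := step n.
  by apply: le_tr (wb_le av) (wb_le vx).
split=> // k n kn; apply: le_tr (le_nmul _ (incr_le incf kn)) _.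
apply: le_tr (step n).2.2 _; apply: le_nmul; exact: (proj1 supw).
Qed.

End CuTheory.

(** * Functionals and the conclusion *)

Local Open Scope ereal_scope.

Lemma functional_nmul (S : CuSemigroup) (lam : S -> \bar Rdefinitions.R)
    (n : nat) (x : S) :
  functional lam -> lam (nmul (@cu_add S) (@cu_zero S) n x) = lam x *+ n.
Proof.
move=> [_ [lam0 [lamD _]]]; elim: n => [|n IH] //.
by rewrite muleS addeC -IH -lamD.
Qed.

(** For finite values the ratio [(n + 2) / (n + 1)] tends to 1; an infinite [p] forces [b] infinite
    by a single instance. *)
Lemma le_of_ratio_le (R : realType) (k : nat) (p b : \bar R) : 0 <= p -> 0 <= b ->
  (forall n, (k <= n)%N -> p *+ n.+1 <= b *+ n.+2) -> p <= b.
Proof.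
case: b => [b| |] // p0 b0; last by rewrite leey.
case: p p0 => [p| |] // p0 ratio; last first.
  by have := ratio k (leqnn k); rewrite enatmul_pinfty -EFin_natmul leye_eq.
rewrite lee_fin leNgt; apply/negP => lt_bp.
(* With [m (p - b) > b], the instance [n = k + m] fails, as it says [(k + m + 1) (p - b) <= b]. *)
have /archi_boundP : (0 <= b / (p - b))%R.
  by rewrite divr_ge0 // subr_ge0 ltW.
move: (Num.Def.archi_bound _) => m; rewrite ltr_pdivrMr ?subr_gt0 // => lt_bm.
have := ratio (k + m)%N (leq_addr m k).
rewrite -!EFin_natmul lee_fin !mulrS.
rewrite !mulrnDr -!(mulr_natr p) -!(mulr_natr b).
have : (0 <= k%:R * (p - b))%R by rewrite mulr_ge0 // subr_ge0 ltW.
by move: lt_bp lt_bm; lra.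
Qed.

Theorem theorem5p10 (S : CuSemigroup)
  (hdiv : two_omega_divisible S) (h5 : O5 S) (h6 : O6 S) (h7 : O7 S)
  (x u' : S) (hu' : L_set x u') :
  exists w : S,
    strongly_soft w /\
    way_below (@cu_le S) u' w /\ cu_le w x /\
    le_infty (@cu_add S) (@cu_zero S) (@cu_le S) x w /\
    (forall lam : S -> \bar Rdefinitions.R, functional lam -> lam w = lam x).
Proof.
have [w [f [softw u'w wx [incf supf ratio]]]] := L_set_limit hdiv h5 h6 h7 hu'.
exists w; do 3!split=> //; split.
  have [s sups] := cu_O1 (incr_nmul w); exists s; split=> //.
  (* Taking [n = k] in [ratio] bounds [f k] by the multiple [k.+2] of [w]. *)
  apply: supf.2 => k; apply: cu_le_trans (sups.1 k.+2).
  by apply: cu_le_trans (ratio k k (leqnn k)); apply: le_addl.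
move=> lam flam; have [lam_ge0 [_ [_ [lam_le lam_sup]]]] := flam.
apply/eqP; rewrite eq_le lam_le //=; apply: (lam_sup f x incf supf).2 => k.
apply: (@le_of_ratio_le _ k) => // n kn.
by rewrite -!functional_nmul //; apply: lam_le; apply: ratio.
Qed.
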